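(* Let $i\in\{0,1\}$ and let $j,s$ be integers with $0\le j\le\delta_{i,0}$ (Kronecker delta) and $s\ge j$. Then $$\rho^i_{\neq}(2s-j)=\sum_{l\ge0}\rho_{2l+j}\bigl(s-2l^2-(2j-i)l-j\bigr),$$ where the sum is over all integers $l\ge0$.
   Context: For integers $m>0$ and $k\ge0$, $\rho_k(m)$ denotes the number of partitions of $m$ with all parts at most $k$; $\rho_k(0)=1$ and $\rho_k(m)=0$ if $m<0$. For an integer $k\ge0$ and $i\in\{0,1\}$, $\rho^i_{\neq}(k)$ is the number of partitions of $k$ with all parts distinct and having parity different from that of $i$ (so odd distinct parts if $i=0$, even distinct parts if $i=1$); the empty partition is counted, so $\rho^i_{\neq}(0)=1$. *)

(* Defs.v *)
From mathcomp Require Import all_boot all_order all_algebra.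

Set Implicit Arguments.
Unset Strict Implicit.
Unset Printing Implicit Defensive.

Definition is_partition (n : nat) (p : seq nat) : bool :=
  [&& sorted geq p, 0 \notin p & sumn p == n].

(* A partition of n has at most n parts, each at most n, so the finite type
   n.-bseq 'I_n.+1 used by num_partitions contains every partition of n. *)
Lemma is_partition_bounded n p :
  is_partition n p -> (size p <= n) && all (fun a => a < n.+1) p.
Proof.
case/and3P=> _; elim: p n => [|a p IHp] n //=.
rewrite inE negb_or eq_sym -lt0n => /andP[a_gt0 p_n0] /eqP <-.
have /andP[szp /allP ltp] := IHp _ p_n0 (eqxx _).
rewrite ltnS leq_addr -add1n leq_add //=; apply/allP=> b /ltp.
by rewrite !ltnS => /leq_trans-> //; exact: leq_addl.
Qed.

Lemma is_partition_bseq n p :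
  is_partition n p -> exists q : n.-bseq 'I_n.+1, map val q = p.
Proof.
move=> /is_partition_bounded/andP[szp ltp].
have szq : size (map (@inord n) p) <= n by rewrite size_map.
exists (Bseq szq); rewrite /= -map_comp -[RHS]map_id.
by apply/eq_in_map => a /(allP ltp) lta /=; rewrite inordK.
Qed.

Definition num_partitions (Q : pred (seq nat)) (n : nat) : nat :=
  #|[set p : n.-bseq 'I_n.+1 | is_partition n (map val p) & Q (map val p)]|.

Definition rho (k : nat) (m : int) : nat :=
  match m with
  | Posz n => num_partitions (all (fun a => a <= k)) n
  | Negz _ => 0
  end.

Definition rho_neq (i k : nat) : nat :=
  num_partitions (fun p => uniq p && all (fun a => odd a != odd i) p) k.

(* Main.v *)
Require Import Defs.
From mathcomp Require Import all_boot all_order all_algebra.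
From mathcomp Require Import classical_sets cardinality fsbigop.
From mathcomp Require Import zify.
Import Order.TTheory GRing.Theory Num.Theory.

(* The number of strictly decreasing sequences of m naturals with sum n is
   rho m (n - 'C(m, 2)): remove the staircase (m-1, ..., 1, 0) and conjugate.
   Writing the parts as 2a+1 when i = 0, and as 2a with a possible a = 0 when
   i = 1, the distinct parts become such a sequence of length m = 2l+j (for
   i = 0, m has the parity of the partitioned number 2s-j; for i = 1, the optional
   part 0 makes m even), and the l-th summand counts those of length 2l+j. *)

(** * Counting partitions by explicit lists, fibres and bijections *)

(** Passing from the cardinal over bounded sequences to a list of plain sequences lets later counts
    be compared by list operations, free of the bounds in the finite type. *)
Lemma num_partitions_enum (Q : pred (seq nat)) n : exists L : seq (seq nat),
  [/\ uniq L, forall p, (p \in L) = is_partition n p && Q p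
    & size L = num_partitions Q n].
Proof.
pose L := [seq map val (bseqval p)
  | p <- enum [set p : n.-bseq 'I_n.+1 | is_partition n (map val p) & Q (map val p)]].
have uL : uniq L.
  rewrite map_inj_uniq ?enum_uniq // => p q /(inj_map val_inj) eq_pq.
  exact: val_inj.
exists L; split=> // [p|]; last by rewrite size_map -cardE.
apply/mapP/idP => [[q]|pP].
  by rewrite mem_enum inE => qP ->.
have [q qp] : exists q : n.-bseq 'I_n.+1, map val q = p.
  by case/andP: pP => /is_partition_bseq.
by exists q => //; rewrite mem_enum inE /= qp.
Qed.

Lemma num_partitionsE (Q : pred (seq nat)) n (L : seq (seq nat)) :
  uniq L -> (forall p, (p \in L) = is_partition n p && Q p) ->
  num_partitions Q n = size L.
Proof.
move=> uL memL; have [L' [uL' memL' <-]] := num_partitions_enum Q n.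
by apply/perm_size/uniq_perm => // p; rewrite memL memL'.
Qed.

Lemma eq_num_partitions (Q Q' : pred (seq nat)) n :
  (forall p, is_partition n p -> Q p = Q' p) ->
  num_partitions Q n = num_partitions Q' n.
Proof.
move=> eqQ; apply: eq_card => p; rewrite !inE.
by apply: andb_id2l => /eqQ.
Qed.

Lemma num_partitions_fiber (Q : pred (seq nat)) n (f : seq nat -> nat) :
  (forall p, is_partition n p -> f p <= n) ->
  num_partitions Q n =
    \sum_(l < n.+1) num_partitions (fun p => Q p && (f p == l)) n.
Proof.
move=> f_le; rewrite /num_partitions -sum1_card.
rewrite (partition_big (fun p : n.-bseq 'I_n.+1 => inord (f (map val p)) : 'I_n.+1) xpredT) //=.
apply: eq_bigr => l _; rewrite -sum1_card; apply: eq_bigl => p.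
rewrite !inE andbA; apply: andb_id2l => /andP[/f_le fp_le _].
by rewrite -val_eqE /= inordK.
Qed.

(** The members of [D] need not be partitions: the lemma is applied to decreasing sequences that may
    end in 0. *)
Lemma num_partitions_bij (Q : pred (seq nat)) n (D : pred (seq nat)) (L : seq (seq nat))
    (f g : seq nat -> seq nat) :
  uniq L -> (forall q, (q \in L) = D q) ->
  (forall q, D q -> [/\ is_partition n (f q), Q (f q) & g (f q) = q]) ->
  (forall p, is_partition n p -> Q p -> D (g p) /\ f (g p) = p) ->
  num_partitions Q n = size L.
Proof.
move=> uL memL fP gP; rewrite -(size_map f); apply: num_partitionsE.
  rewrite map_inj_in_uniq // => p q; rewrite !memL => /fP[_ _ gfp] /fP[_ _ gfq] eq_f.
  by rewrite -gfp eq_f.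
move=> p; apply/mapP/andP => [[q]|[pn Qp]].
  by rewrite memL => /fP[pn Qp _] ->.
by have [Dg fg] := gP p pn Qp; exists (g p); rewrite ?memL.
Qed.

(** * Initial values and recursion for [rho] *)

Lemma rho_lt0 k m : (m < 0)%R -> rho k m = 0.
Proof. by case: m. Qed.

Lemma rho0 n : rho 0 n%:Z = (n == 0).
Proof.
rewrite /= (@num_partitionsE _ _ (nseq (n == 0) [::])) ?size_nseq //.
  by case: eqP.
case=> [|a p]; rewrite mem_nseq /is_partition /=.
  by rewrite eq_sym; case: (0 == n).
by rewrite inE; case: a => [|a]; rewrite /= ?andbF.
Qed.

(* Either all parts are at most k, or the first part is k+1. *)
Lemma rhoS k n :
  rho k.+1 n%:Z = rho k n%:Z + (if k < n then rho k.+1 (n - k.+1)%:Z else 0).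
Proof.
rewrite /=.
have [L1 [uL1 memL1 <-]] := num_partitions_enum (all (fun a => a <= k)) n.
have [L2 [uL2 memL2 <-]] := num_partitions_enum (all (fun a => a <= k.+1)) (n - k.+1).
rewrite (@num_partitionsE _ _ (L1 ++ (if k < n then map (cons k.+1) L2 else [::]))).
- by rewrite size_cat; case: ifP; rewrite ?size_map.
- rewrite cat_uniq uL1 /=; case: ifP => //= _.
  rewrite map_inj_uniq ?uL2 ?andbT; last by move=> p q [].
  apply/hasPn => _ /mapP[p _ ->]; rewrite memL1 /= ltnn.
  by rewrite andbF.
move=> p; rewrite mem_cat memL1.
(* The default of [head] is harmless: on the empty partition it gives 0, which is never k+1. *)
have -> : (p \in (if k < n then map (cons k.+1) L2 else [::])) =
    [&& is_partition n p, all (fun a => a <= k.+1) p & head 0 p == k.+1].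
  case: p => [|a p].
    by rewrite andbF; case: ifP => // _; apply/negP => /mapP[].
  have -> : (a :: p \in if k < n then [seq k.+1 :: i | i <- L2] else [::]) =
      [&& k < n, a == k.+1 & p \in L2].
    case: ifP => //= _; case: eqP => [->|ne] /=.
      by rewrite mem_map // => p' q' [].
    by apply/negP => /mapP[q _ []].
  rewrite memL2 /is_partition /= inE negb_or.
  case: (a =P k.+1) => [->|_]; last by rewrite !andbF.
  rewrite (@path_sortedE _ geq); last by move=> x y z /= h1 h2; exact: leq_trans h2 h1.
  rewrite leqnn andbT /=.
  have -> : all (geq k.+1) p = all (fun a0 => a0 <= k.+1) p by apply: eq_all.
  have -> : (k.+1 + sumn p == n) = (k < n) && (sumn p == n - k.+1) by lia.
  by case: (k < n) (all _ p) (sorted geq p) (0 \in p) (_ == _) => [] [] [] [] [].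
(* As p is weakly decreasing, its first part bounds the others, so comparing that part with k+1
   decides every condition. *)
rewrite -andb_orr; apply: andb_id2l => /and3P[+ _ _].
case: p => [|a p] //=.
rewrite (@path_sortedE _ geq); last by move=> x y z /= h1 h2; exact: leq_trans h2 h1.
case/andP => /allP alla _.
have allk m : a <= m -> all (fun a => a <= m) p.
  by move=> am; apply/allP => b /alla /= ba; exact: leq_trans ba am.
case: (ltngtP a k.+1) => [ak|ka|eq_a] /=.
- by rewrite ltnS in ak; rewrite ak !allk // ltnW.
- by rewrite leqNgt (ltnW ka).
- by rewrite (allk k.+1) eq_a ?ltnn ?andbT.
Qed.

(** * Strictly decreasing sequences of naturals *)

Lemma gtn_trans : transitive gtn.
Proof. by move=> x y z /= h1 h2; exact: ltn_trans h2 h1. Qed.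

(** The head exceeds the distinct entries of the tail, hence is at least their number; summing gives
    at least the staircase 0 + 1 + ... + (m-1). *)
Lemma leq_bin2_sumn q : sorted gtn q -> 'C(size q, 2) <= sumn q.
Proof.
elim: q => [|a q IHq] //= /[dup] /path_sorted /[dup] sq /IHq leq_q.
rewrite path_sortedE; last exact: gtn_trans.
case/andP => /allP qa _.
suff : size q <= a by rewrite binS bin1; lia.
rewrite -(size_iota 0 a); apply: uniq_leq_size => [|b /qa /=].
  by move: sq; rewrite gtn_sorted_uniq_geq => /andP[].
by rewrite mem_iota.
Qed.

Lemma sumn_map_succ q : sumn (map succn q) = sumn q + size q.
Proof. by elim: q => //= a q ->; lia. Qed.

Lemma sorted_map_succ q : sorted gtn (map succn q) = sorted gtn q.
Proof. exact: mono_sorted. Qed.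

Lemma sorted_rcons0 q : sorted gtn (rcons (map succn q) 0) = sorted gtn q.
Proof.
rewrite -cats1 sorted_pairwise; last exact: gtn_trans.
rewrite pairwise_cat /= andbT -sorted_pairwise ?sorted_map_succ; last exact: gtn_trans.
rewrite andbC; case: sorted => //=.
by apply/allrelP => x y /mapP[z _ ->]; rewrite inE => /eqP ->.
Qed.

(** Strict decrease allows 0 only as the last entry; all other entries are successors. This
    dichotomy mirrors the two terms of [rhoS]. *)
Lemma sorted_gtn_succ q : sorted gtn q ->
  exists q', q = map succn q' \/ q = rcons (map succn q') 0.
Proof.
move=> sq; case: (boolP (0 \in q)) => [|n0].
  case/lastP: q sq => [|q a] //.
  rewrite -cats1 sorted_pairwise; last exact: gtn_trans.
  rewrite pairwise_cat mem_cat inE => /and3P[/allrelP qa _ _].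
  have a0 b : b \in q -> 0 < b.
    by move=> bq; apply: leq_ltn_trans (qa b a bq (mem_head _ _)).
  case/orP => [/a0 //|/eqP <-]; exists (map predn q); right.
  rewrite cats1 -map_comp map_id_in // => b /a0; exact: prednK.
exists (map predn q); left; rewrite -map_comp map_id_in // => b bq /=.
by apply: prednK; rewrite lt0n; apply: contra n0 => /eqP <-.
Qed.

(** The entry 0 is allowed, so these encode the m-element sets of naturals with sum n. *)
Definition decreasing_seqs m n : pred (seq nat) :=
  fun q => [&& sorted gtn q, size q == m & sumn q == n].

(* Both sides satisfy the recursion rhoS: lowering every entry by 1 is possible
   exactly when the last entry is not 0, and if it is 0 it is dropped first. *)
Lemma decreasing_seqs_enum_add m n : exists L : seq (seq nat),
  [/\ uniq L, forall q, (q \in L) = decreasing_seqs m (n + 'C(m, 2)) q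
    & size L = rho m n%:Z].
Proof.
elim: m n => [|m IHm] n.
  exists (nseq (n == 0) [::]); split; [by case: eqP | | by rewrite rho0 size_nseq].
  case=> [|a q]; rewrite mem_nseq /decreasing_seqs /= ?andbF //.
  by rewrite addn0 eq_sym; case: (0 == n).
(* Dropping a final 0 lowers m, but lowering all entries keeps the length m+1 and decreases n by
   m+1; hence a strong induction on n inside the one on m. *)
elim/ltn_ind: n => n IHn.
have [L1 [uL1 memL1 sz1]] := IHm n.
have [L2 [uL2 memL2 sz2]] : exists L : seq (seq nat),
  [/\ uniq L, forall q, (q \in L) = (m < n) && decreasing_seqs m.+1 (n - m.+1 + 'C(m.+1, 2)) q
    & size L = if m < n then rho m.+1 (n - m.+1)%:Z else 0].
  case: ltnP => lt_mn; last by exists [::].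
  by apply: IHn; lia.
exists (map (fun q => rcons (map succn q) 0) L1 ++ map (map succn) L2).
have inj1 : injective (fun q => rcons (map succn q) 0).
  by move=> p q /rcons_inj[] /(inj_map succn_inj).
have inj2 : injective (map succn) by exact: inj_map succn_inj.
have no0 q : (0 \in map succn q) = false by elim: q.
split.
- rewrite cat_uniq !map_inj_uniq // uL1 uL2 andbT /=.
  apply/hasPn => _ /mapP[p _ ->]; apply/negP => /mapP[q _ eq_pq].
  by have := no0 p; rewrite eq_pq mem_rcons inE.
- move=> q; rewrite mem_cat.
  have [sq|nsq] := boolP (sorted gtn q); last first.
    rewrite /decreasing_seqs (negbTE nsq) /=; apply/negbTE.
    apply: contra nsq => /orP[] /mapP[p + ->]; rewrite ?memL1 ?memL2.
      by rewrite sorted_rcons0 => /and3P[].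
    by rewrite sorted_map_succ => /andP[_ /and3P[]].
  have [p [eq_q|eq_q]] := sorted_gtn_succ q sq; subst q.
    have -> : (map succn p \in [seq rcons (map succn q) 0 | q <- L1]) = false.
      by apply/negP => /mapP[q _ eq_pq]; have := no0 p; rewrite eq_pq mem_rcons inE.
    rewrite /= mem_map // memL2 /decreasing_seqs sorted_map_succ size_map sumn_map_succ.
    rewrite sorted_map_succ in sq; rewrite sq /=.
    (* The staircase bound on p forces m < n, so the truncated difference n - (m+1) is a true
       one. *)
    have := leq_bin2_sumn p sq; case: eqP => [->|]; last by rewrite andbF.
    by rewrite /= binS bin1; lia.
  have -> : (rcons (map succn p) 0 \in map (map succn) L2) = false.
    by apply/negP => /mapP[q _ eq_pq]; have := no0 q; rewrite -eq_pq mem_rcons inE.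
  rewrite orbF (mem_map inj1) memL1 /decreasing_seqs sorted_rcons0 size_rcons size_map.
  rewrite sumn_rcons sumn_map_succ eqSS binS bin1.
  by congr andb; apply: andb_id2l => /eqP ->; lia.
- by rewrite size_cat !size_map sz1 sz2 (rhoS m n).
Qed.

(** If n lies below the staircase sum, no such sequence exists, in agreement with [rho] being 0 at
    negative arguments. *)
Lemma decreasing_seqs_enum m n : exists L : seq (seq nat),
  [/\ uniq L, forall q, (q \in L) = decreasing_seqs m n q
    & size L = rho m (n%:Z - 'C(m, 2)%:Z)%R].
Proof.
have [le_mn|lt_nm] := leqP 'C(m, 2) n.
  have [L [uL memL szL]] := decreasing_seqs_enum_add m (n - 'C(m, 2)).
  exists L; split=> // [q|]; first by rewrite memL subnK.
  by rewrite szL subzn.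
exists [::]; split=> // [q|]; last by rewrite rho_lt0 // subr_lt0.
apply/esym/negP => /and3P[sq /eqP szq /eqP sumq].
by have := leq_bin2_sumn q sq; rewrite szq sumq leqNgt lt_nm.
Qed.

(** * Distinct parts of one parity, classified by their number *)

(** The index is half the number of parts, rounded down for odd parts (i = 0) and up for even parts
    (i = 1), where an adjoined 0 may complete the length to 2l. *)
Lemma rho_neq_fiber i k : rho_neq i k = \sum_(l < k.+1)
  num_partitions (fun p => (uniq p && all (fun a => odd a != odd i) p)
     && ((size p + odd i)./2 == l)) k.
Proof.
apply: num_partitions_fiber => p /is_partition_bounded/andP[szp _].
have [] := posnP k; last by case: odd; lia.
by move=> k0; subst k; case: odd; lia.
Qed.

Lemma odd_sumn p : all odd p -> odd (sumn p) = odd (size p).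
Proof. by elim: p => //= a p IHp /andP[oa /IHp]; rewrite oddD oa => ->. Qed.

Lemma sumn_map_double q : sumn (map double q) = (sumn q).*2.
Proof. by elim: q => //= a q ->; lia. Qed.

Lemma sumn_map_doubleS q : sumn (map (fun a => a.*2.+1) q) = (sumn q).*2 + size q.
Proof. by elim: q => //= a q ->; lia. Qed.

(** Halving is strictly monotone on numbers of equal parity. *)
Lemma sorted_map_half p i : all (fun a => odd a == i) p ->
  sorted gtn (map half p) = sorted gtn p.
Proof.
move=> /allP pi; rewrite sorted_map; apply: (@eq_in_sorted _ (fun a => odd a == i)).
  by move=> a b /eqP oa /eqP ob /=; lia.
exact/allP.
Qed.

Lemma bin2_mul2D1 l : 'C(2 * l + 1, 2) = 2 * l ^ 2 + l.
Proof.
rewrite bin2odd; last by lia.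
have -> : (2 * l + 1).-1./2 = l by lia.
by rewrite expnS expn1; lia.
Qed.

Lemma bin2_mul2 l : 'C(2 * l, 2) + l = 2 * l ^ 2.
Proof. by have := bin2_mul2D1 l; rewrite addn1 binS bin1; lia. Qed.

Lemma num_odd_distinct l j s : j <= 1 -> j <= s ->
  num_partitions (fun p => [&& uniq p, all odd p & (size p)./2 == l]) (2 * s - j) =
  rho (2 * l + j)
    (s%:Z - 2 * l%:Z ^+ 2 - (2 * j%:Z) * l%:Z - j%:Z)%R.
Proof.
move=> hj hs.
(* The number of odd parts has the parity of their sum 2s-j, which fixes the remainder lost by
   halving. *)
have sizeE p : is_partition (2 * s - j) p -> all odd p ->
    (size p)./2 == l -> size p = 2 * l + j.
  by case/and3P => _ _ /eqP sump /odd_sumn; lia.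
(* If s < l+j, both sides vanish: the argument of [rho] is negative, and 2l+j parts exceed the total
   2s-j. *)
have [le_ls|lt_sl] := leqP (l + j) s; last first.
  have le_ll : l <= l * l by rewrite leq_pmulr; lia.
  rewrite rho_lt0; last by nia.
  rewrite (@num_partitionsE _ _ [::]) // => p; apply/esym/negP.
  case/and4P => pn _ /(sizeE p pn) /[apply] szp.
  by have /andP[] := is_partition_bounded pn; lia.
(* Removing 1 from each of the 2l+j odd parts and halving turns the sum 2s-j into s-l-j. *)
have [L [uL memL szL]] := decreasing_seqs_enum (2 * l + j) (s - l - j).
rewrite (@num_partitions_bij _ _ _ L (map (fun a => a.*2.+1)) (map half) uL memL).
- rewrite szL; congr rho.
  have := bin2_mul2 l; have := bin2_mul2D1 l.
  by move: hj le_ls; case: j {hs sizeE memL szL} => [|[|]] //; rewrite ?addn0; lia.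
- move=> q /and3P[sq /eqP szq /eqP sumq].
  have : sorted gtn [seq a.*2.+1 | a <- q].
    by rewrite (@mono_sorted _ _ _ gtn) // => a b /=; lia.
  rewrite gtn_sorted_uniq_geq => /andP[uq gq]; split.
  + rewrite /is_partition gq /= sumn_map_doubleS sumq szq.
    apply/andP; split; last by lia.
    by apply/mapP => -[].
  + rewrite uq /= size_map szq; apply/andP; split; last by lia.
    by rewrite all_map; apply/allP => a _ /=; rewrite odd_double.
  + by rewrite -map_comp map_id_in // => a _ /=; rewrite uphalf_double.
- move=> p pn /and3P[up op szp].
  have {}szp := sizeE p pn op szp.
  have fgp : [seq a.*2.+1 | a <- map half p] = p.
    rewrite -map_comp map_id_in // => a /(allP op) /=; lia.
  split=> //.
  case/and3P: pn => gp _ /eqP sump.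
  apply/and3P; split.
  + rewrite (@sorted_map_half p true).
      by rewrite gtn_sorted_uniq_geq up.
    by apply: sub_all op => a ->.
  + by rewrite size_map szp.
  + by have := sumn_map_doubleS (map half p); rewrite fgp size_map; lia.
Qed.

Lemma sorted_gtn_filter q : sorted gtn q ->
  q = [seq a <- q | 0 < a] ++ nseq (0 \in q) 0.
Proof.
move=> /sorted_gtn_succ[p [] ->].
  have -> : (0 \in map succn p) = false by apply/mapP => -[].
  by rewrite cats0; apply/esym/all_filterP; rewrite all_map; apply/allP.
rewrite mem_rcons mem_head /= filter_rcons /= cats1; congr rcons.
by apply/esym/all_filterP; rewrite all_map; apply/allP.
Qed.

(* A set of 2l-1 or 2l distinct positive numbers becomes, by adjoining 0 when
   needed, a set of exactly 2l distinct naturals. *)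
Lemma num_even_distinct l s :
  num_partitions (fun p => [&& uniq p, all (predC odd) p & uphalf (size p) == l]) (2 * s) =
  rho (2 * l) (s%:Z - 2 * l%:Z ^+ 2 + l%:Z)%R.
Proof.
have [L [uL memL szL]] := decreasing_seqs_enum (2 * l) s.
(* Forward, a possible 0 is discarded and the rest doubled; backward, the parts are halved and
   padded with 0 to length 2l. *)
rewrite (@num_partitions_bij _ _ _ L (fun q => [seq a.*2 | a <- q & 0 < a])
   (fun p => map half p ++ nseq (2 * l - size p) 0) uL memL).
- by rewrite szL; congr rho; have := bin2_mul2 l; lia.
- move=> q /and3P[sq /eqP szq /eqP sumq].
  have eq_q := sorted_gtn_filter q sq.
  set q' := filter _ _ in eq_q *.
  have sq' : sorted gtn q' by apply: sorted_filter => //; exact: gtn_trans.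
  have : sorted gtn [seq a.*2 | a <- q'].
    by rewrite (@mono_sorted _ _ _ gtn) // => a b /=; lia.
  have szq' : size q' + (0 \in q) = 2 * l by rewrite -szq [in RHS]eq_q size_cat size_nseq.
  rewrite gtn_sorted_uniq_geq => /andP[uq gq]; split.
  + rewrite /is_partition gq /= sumn_map_double; apply/andP; split.
      apply/mapP => -[a]; rewrite mem_filter => /andP[]; lia.
    by rewrite -sumq eq_q sumn_cat sumn_nseq mul0n addn0 -mul2n.
  + rewrite uq /= size_map; apply/andP; split; last by lia.
    by rewrite all_map; apply/allP => a _ /=; rewrite odd_double.
  + rewrite -map_comp map_id_in; last by move=> a _ /=; rewrite doubleK.
    by rewrite size_map -szq' addKn -eq_q.
- move=> p pn /and3P[up ep /eqP szp].
  case/and3P: pn => gp p0 /eqP sump.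
  have fgp : [seq a.*2 | a <- map half p] = p.
    rewrite -map_comp map_id_in // => a /(allP ep) /=; lia.
  have hp0 a : a \in map half p -> 0 < a.
    move=> ap; rewrite lt0n; apply: contra p0 => /eqP a0.
    by rewrite -fgp -[0]/(0.*2) map_f // -a0.
  split; last first.
    rewrite filter_cat filter_nseq /= cats0.
    by have /all_filterP -> : all (ltn 0) (map half p) by apply/allP.
  apply/and3P; split.
  + rewrite sorted_pairwise; last exact: gtn_trans.
    rewrite pairwise_cat -sorted_pairwise; last exact: gtn_trans.
    apply/and3P; split.
    * by apply/allrelP => a b /hp0 a0; rewrite mem_nseq => /andP[_ /eqP ->].
    * rewrite (@sorted_map_half p false) ?gtn_sorted_uniq_geq ?up //.
      by apply: sub_all ep => a /negbTE /= ->.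
    (* Rounding up makes the padding at most a single 0, so the sequence stays strictly
       decreasing. *)
    * by have : 2 * l - size p <= 1 by [lia]; case: (_ - _) => [|[|]].
  + by rewrite size_cat size_map size_nseq; lia.
  + rewrite sumn_cat sumn_nseq mul0n addn0.
    by have := sumn_map_double (map half p); rewrite fgp; lia.
Qed.

(** * Finite support and summation over l *)

Theorem mainTheorem6 (i j s : nat) (hi : i = 0 \/ i = 1)
    (hj : j <= (i == 0)) (hs : j <= s) :
  let F (l : nat) : nat :=
    rho (2 * l + j)
      (s%:Z - 2 * l%:Z ^+ 2 - (2 * j%:Z - i%:Z) * l%:Z - j%:Z)%R in
  finite_set [set l | F l != 0]%classic /\
  rho_neq i (2 * s - j) = \big[addn/0]_(l \in [set: nat]%classic) F l.
Proof.
move=> F.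
(* Beyond 2s-j the quadratic term makes the argument of [rho] negative, so the support lies in the
   index range of [rho_neq_fiber]. *)
have F0 l : (2 * s - j).+1 <= l -> F l = 0.
  by move=> le_l; apply: rho_lt0; case: hi => ?; subst i; nia.
have Fi l : l \notin iota 0 (2 * s - j).+1 -> F l = 0.
  by rewrite mem_iota /= add0n -leqNgt => /F0.
split.
  apply: (@sub_finite_set _ _ [set` iota 0 (2 * s - j).+1]%classic); last exact: finite_seq.
  by move=> l /=; apply: contraR => /Fi ->.
rewrite (@fsbigE _ _ _ _ _ (iota 0 (2 * s - j).+1)) ?iota_uniq //; last first.
  by move=> l _; exact: Fi.
rewrite rho_neq_fiber -[iota _ _]/(index_iota 0 (2 * s - j).+1).
rewrite big_mkord; apply: eq_big => [l|l _]; first by rewrite in_setT.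
rewrite /F; move: (nat_of_ord l) => {}l; case: hi => ?; subst i.
  rewrite subr0 -num_odd_distinct //; apply: eq_num_partitions => p _.
  rewrite addn0 -andbA; congr (_ && (_ && _)).
  by apply: eq_all => a; case: odd.
have ?: j = 0 by lia. subst j.
have -> : (s%:Z - 2 * l%:Z ^+ 2 - (2 * 0%:Z - 1%:Z) * l%:Z - 0%:Z =
  s%:Z - 2 * l%:Z ^+ 2 + l%:Z)%R by lia.
rewrite addn0 subn0 -num_even_distinct; apply: eq_num_partitions => p _.
rewrite addn1 -andbA; congr (_ && (_ && _)).
by apply: eq_all => a /=; case: odd.
Qed.
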